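(* Let $N\ge3$ be an integer and let $W\in\big(0,\frac{2}{e\pi}\frac{N-1}{N}\big)$. Then for every integer $k$ with $$2\le\frac{e\pi}{2}NW\le k\le N-1,$$ one has $$\widetilde\lambda_{k,N}(W)\le 2\,e^{-(2k+1)\log\left(\frac{2}{e\pi NW}(k+1)\right)} .$$
   Context: For $W\in(0,1/2)$ and an integer $N\ge1$, let $\widetilde Q_{W,N}$ be the positive, self-adjoint integral operator of rank $N$ on $L^2(-W,W)$ given by $$\widetilde Q_{W,N}f(x)=\int_{-W}^{W}\frac{\sin(N\pi(x-y))}{\sin(\pi(x-y))}f(y)\,dy.$$ Its $N$ nonzero eigenvalues, in decreasing order, are denoted $1>\widetilde\lambda_{0,N}(W)>\widetilde\lambda_{1,N}(W)>\cdots>\widetilde\lambda_{N-1,N}(W)>0$. Equivalently, they are the eigenvalues of the $N\times N$ Toeplitz matrix $\left[\frac{\sin(2\pi(n-m)W)}{\pi(n-m)}\right]_{0\le n,m\le N-1}$ (diagonal entries $2W$). Here $e$ is Euler's number and $\log$ the natural logarithm. *)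

(* Defs.v *)
From HB Require Import structures.
From mathcomp Require Import all_boot all_order all_algebra.
From mathcomp Require Import all_classical all_reals all_analysis.

Set Implicit Arguments.
Unset Strict Implicit.
Unset Printing Implicit Defensive.

Import Order.TTheory GRing.Theory Num.Theory.
Import numFieldNormedType.Exports.

Local Open Scope classical_set_scope.
Local Open Scope ring_scope.

Section SincOperator.
Context {R : realType}.
Implicit Types (W : R) (N : nat) (f : R -> R).

(* Lebesgue measure carried by (-W, W). An element of L^2(-W, W) is given by a
   representative f : R -> R with f \in Lfun (mu_itv W) 2%:E; only its values
   on (-W, W) matter, and equality of elements is equality mu_itv W-a.e. *)
Definition mu_itv W : {measure set (measurableTypeR R) -> \bar R} :=
  mrestr lebesgue_measure (measurable_itv `]- W, W[).

(* For W < 1/2 the denominator vanishes on (-W, W)^2 only on the diagonal, where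
   the quotient is 0 here instead of N; being null in y for each fixed x, the
   diagonal does not affect the operator below. *)
Definition Qkernel N (t : R) : R := sin (N%:R * pi * t) / sin (pi * t).

Definition Qtilde W N f : R -> R := fun x =>
  \int[@lebesgue_measure R]_(y in `]- W, W[) (Qkernel N (x - y) * f y).

(* f belongs to the eigenspace of Qtilde W N for a; f may be 0. *)
Definition in_eigenspace W N (a : R) f : Prop :=
  f \in Lfun (mu_itv W) 2%:E /\
  {ae mu_itv W, forall x, Qtilde W N f x = a * f x}.

Definition lin_indep W n (psi : 'I_n -> R -> R) : Prop :=
  forall c : 'I_n -> R,
    {ae mu_itv W, forall x, \sum_(i < n) c i * psi i x = 0} ->
    forall i, c i = 0.

Definition in_span W n (psi : 'I_n -> R -> R) f : Prop :=
  exists c : 'I_n -> R,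
    {ae mu_itv W, forall x, f x = \sum_(i < n) c i * psi i x}.

(* lam lists the N nonzero eigenvalues of Qtilde W N in decreasing order, each
   repeated according to the dimension of its eigenspace: psi is a basis of the
   sum of the eigenspaces for nonzero eigenvalues. These eigenvalues are in fact
   simple, so that lam is strictly decreasing, but this is not required. *)
Definition nonzero_eigenvalues W N (lam : 'I_N -> R) : Prop :=
  [/\ forall i j : 'I_N, (i <= j)%N -> lam j <= lam i,
      forall i, lam i != 0
    & exists psi : 'I_N -> R -> R,
      [/\ forall i, in_eigenspace W N (lam i) (psi i),
          lin_indep W psi
        & forall a f, a != 0 -> in_eigenspace W N a f -> in_span W psi f]].

End SincOperator.

Arguments nonzero_eigenvalues {R} W N lam.

(* Main.v *)
Require Import Defs.
From HB Require Import structures.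
From mathcomp Require Import all_boot all_order all_algebra.
From mathcomp Require Import all_classical all_reals all_analysis.
From mathcomp Require Import measurable_realfun ring lra.
Import Order.TTheory GRing.Theory Num.Theory.
Import numFieldNormedType.Exports.
Local Open Scope ring_scope.

(** With c_j = (N - 1 - 2j) pi, the kernel is the sum over j < N of
    cos (c_j (x - y)), so <Q f, f> is the sum of <f, cos c_j>^2 + <f, sin c_j>^2.
    The span of the first k + 1 eigenfunctions contains some f <> 0 orthogonal to
    all polynomials of degree < k, and lam_k |f|^2 <= <Q f, f>. Interpolation at
    the Chebyshev nodes approximates cos c_j and sin c_j on (-W, W) by such
    polynomials up to 2 (|c_j| W / 2)^k / k!, whence, by Cauchy-Schwarz,
    lam_k <= 16 W (pi W / 2)^(2k) / k!^2 * sum_j (N - 1 - 2j)^(2k).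
    The last sum is at most N^(2k+1) / (2k+1) by telescoping, and
    8 (k+1)^(2k+1) <= e^(2k+1) (2k+1) k!^2 for k >= 2 concludes. *)

(** * Power sums and a factorial bound *)

(** Binomial expansion leaves twice C(2k+1, i) x^(2k+1-i) for odd i and nothing for even i. These
    powers of x are even, hence nonnegative, and the term i = 1 is the left side. *)
Lemma odd_power_step (R : realDomainType) (x : R) k :
  2 * k.*2.+1%:R * x ^+ k.*2 <= (x + 1) ^+ k.*2.+1 - (x - 1) ^+ k.*2.+1.
Proof.
have -> : (x + 1) ^+ k.*2.+1 - (x - 1) ^+ k.*2.+1 =
   \sum_(i < k.*2.+2) x ^+ (k.*2.+1 - i) * (1 - (-1) ^+ i) *+ 'C(k.*2.+1, i).
  rewrite !exprDn -sumrB; apply: eq_bigr => i _.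
  by rewrite expr1n mulr1 mulrBr mulr1 mulrnBl.
rewrite (bigD1 (@Ordinal k.*2.+2 1 isT)) //= subSS subn0 bin1.
rewrite -[leLHS]addr0 lerD //.
  by rewrite le_eqVlt -mulr_natr expr1; apply/orP; left; apply/eqP; ring.
apply: sumr_ge0 => i _; apply: mulrn_wge0.
rewrite -signr_odd; case oi: (odd i); last by rewrite expr0 subrr mulr0.
rewrite expr1 opprK mulr_ge0 //.
apply: exprn_even_ge0; rewrite oddB; last by rewrite -ltnS.
by rewrite /= odd_double oi.
Qed.

(** With x = N - 1 - 2j in [odd_power_step], the differences telescope from N^(2k+1) down to
    (-N)^(2k+1), a total of 2 N^(2k+1). *)
Lemma sum_even_power_le (R : realDomainType) N k :
  k.*2.+1%:R * \sum_(j < N) (N%:R - 1 - 2 * j%:R) ^+ k.*2 <= N%:R ^+ k.*2.+1 :> R.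
Proof.
rewrite -(ler_pM2l (ltr0Sn R 1)) mulrA mulr_sumr.
have -> : 2 * N%:R ^+ k.*2.+1 = \sum_(j < N)
   ((N%:R - 2 * j%:R) ^+ k.*2.+1 - (N%:R - 2 * j.+1%:R) ^+ k.*2.+1) :> R.
  rewrite -(big_mkord xpredT (fun j => (N%:R - 2 * j%:R) ^+ k.*2.+1
     - (N%:R - 2 * j.+1%:R) ^+ k.*2.+1 : R)).
  rewrite (@telescope_sumr_eq _ _ _ (fun j => - (N%:R - 2 * j%:R) ^+ k.*2.+1)) //;
    last by move=> j _; rewrite opprK addrC.
  have -> : N%:R - 2 * N%:R = - N%:R :> R by ring.
  rewrite opprK mulr0 subr0 exprNn -signr_odd /= odd_double expr1; ring.
apply: ler_sum => j _.
have := @odd_power_step R (N%:R - 1 - 2 * j%:R) k.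
congr (_ <= _ ^+ _ - _ ^+ _); rewrite ?mulrSr; ring.
Qed.

(** e = exp(1/6)^6 >= (7/6)^6 > 5/2. *)
Lemma expR1_ge52 (R : realType) : 5 / 2 <= expR 1 :> R.
Proof.
have -> : (1 : R) = 6%:R * 6^-1 by rewrite divff.
rewrite expRM_natl; apply: (@le_trans _ _ ((1 + 6^-1) ^+ 6)); first by lra.
by rewrite lerXn2r ?nnegrE ?expR_ge0 ?expR_ge1Dx //; lra.
Qed.

(** Induction from k = 2. With n = k + 1, the step uses ((n + 1)/n)^(2n) <= e^2 and reduces to (n +
    1)(2n - 1) <= n(2n + 1). *)
Lemma factorial_sqr_lower_bound (R : realType) k : (2 <= k)%N ->
  8 * (k%:R + 1) ^+ k.*2.+1 <= expR 1 ^+ k.*2.+1 * k.*2.+1%:R * k`!%:R ^+ 2 :> R.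
Proof.
have e1 := @expR1_ge52 R; elim: k => // k IH; rewrite leq_eqVlt => /orP[/eqP<-|].
  (* The case k = 2 is tight: 8 * 3^5 = 1944, against (5/2)^5 * 5 * 4 > 1953. *)
  have : (5 / 2 : R) ^+ 5 <= expR 1 ^+ 5 by rewrite lerXn2r ?nnegrE //; lra.
  rewrite (_ : _.*2.+1 = 5%N) // (_ : _`! = 2%N) //; lra.
rewrite ltnS => k2; have {}IH := IH k2.
set e := expR 1 in e1 IH *; set n : R := k%:R + 1.
have n0 : 3 <= n by rewrite /n -[3]/(2 + 1)%:R natrD lerD2r ler_nat.
(* (1 + 1/n)^n <= e, since 1 + 1/n <= exp(1/n). *)
have ex : (n + 1) ^+ k.+1 <= e * n ^+ k.+1.
  have -> : n + 1 = n * (1 + n^-1) by field; lra.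
  rewrite exprMn mulrC ler_wpM2r ?exprn_ge0 //; first lra.
  have -> : e = expR (n^-1) ^+ k.+1.
    by rewrite -expRM_natl -natr1 -/n divff //; lra.
  rewrite lerXn2r ?nnegrE ?expR_ge0 ?expR_ge1Dx //.
  by rewrite addr_ge0 // invr_ge0; lra.
have ex2 : (n + 1) ^+ k.*2.+2 <= e ^+ 2 * n ^+ k.*2.+2.
  rewrite -doubleS -!mul2n mulnC !exprM -exprMn lerXn2r ?nnegrE //;
    rewrite ?mulr_ge0 ?exprn_ge0 //; lra.
rewrite -[k.+1%:R]natr1 -/n doubleS factS natrM -[k.+1%:R]natr1 -/n.
have -> : k.*2.+3%:R = 2 * n + 1 :> R by rewrite /n -mul2n -!natr1 natrM; ring.
have k1 : k.*2.+1%:R = 2 * n - 1 :> R by rewrite /n -mul2n -!natr1 natrM; ring.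
rewrite {}k1 -/n in IH.
set f := k`!%:R ^+ 2 in IH.
rewrite exprMn -/f [(n + 1) ^+ _]exprS.
set A := e ^+ k.*2.+1 in IH.
have -> : e ^+ k.*2.+3 = e ^+ 2 * A by rewrite /A -exprD.
have n_pos : 0 < n by lra.
have e_pos : 0 < e by lra.
set P := n ^+ k.*2.+1 in IH.
have P2 : n ^+ k.*2.+2 = n * P by rewrite exprS.
rewrite P2 in ex2.
have Af : 0 <= A * f by rewrite mulr_ge0 // exprn_ge0 //; lra.
apply: (@le_trans _ _ (8 * ((n + 1) * (e ^+ 2 * (n * P))))).
  by rewrite ler_pM2l // ler_pM2l //; lra.
have -> : 8 * ((n + 1) * (e ^+ 2 * (n * P))) = e ^+ 2 * n * ((n + 1) * (8 * P)) by ring.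
have -> : e ^+ 2 * A * (2 * n + 1) * (n ^+ 2 * f) =
  e ^+ 2 * n * (n * (2 * n + 1) * (A * f)) by ring.
rewrite ler_pM2l; last by rewrite mulr_gt0 // exprn_gt0.
apply: (@le_trans _ _ ((n + 1) * (A * (2 * n - 1) * f))).
  by rewrite ler_pM2l //; lra.
have -> : (n + 1) * (A * (2 * n - 1) * f) = ((n + 1) * (2 * n - 1)) * (A * f) by ring.
apply: ler_wpM2r => //; nra.
Qed.

(** * Chebyshev interpolation *)

(** Chebyshev polynomials of the first kind, T_n. *)
Fixpoint cheb {R : nzRingType} n : {poly R} :=
  match n with
  | 0 => 1
  | n'.+1 => match n' with
     | 0 => 'X
     | n''.+1 => 2%:P * 'X * cheb n' - cheb n''
     end
  end.

Lemma chebSS (R : nzRingType) n :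
  cheb n.+2 = 2%:P * 'X * cheb n.+1 - cheb n :> {poly R}.
Proof. by []. Qed.

Lemma horner_cheb_cos (R : realType) n (t : R) : (cheb n).[cos t] = cos (n%:R * t).
Proof.
suff [//] : (cheb n).[cos t] = cos (n%:R * t) /\
            (cheb n.+1).[cos t] = cos (n.+1%:R * t).
elim: n => [|n [IH1 IH2]]; first by rewrite /= mul0r cos0 mul1r !hornerE.
split => //; rewrite chebSS !hornerE IH1 IH2.
have -> : n.+2%:R * t = n.+1%:R * t + t by rewrite -[in LHS]natr1; ring.
have -> : n%:R * t = n.+1%:R * t - t by rewrite -[in RHS]natr1; ring.
rewrite cosB cosD; ring.
Qed.

Lemma size_cheb (R : nzRingType) n : (size (cheb n : {poly R}) <= n.+1)%N.
Proof.
suff [//] : (size (cheb n : {poly R}) <= n.+1)%N /\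
            (size (cheb n.+1 : {poly R}) <= n.+2)%N.
elim: n => [|n [IH1 IH2]]; first by rewrite /= size_poly1 size_polyX.
split => //; rewrite chebSS (leq_trans (size_polyD _ _)) // size_polyN geq_max.
rewrite (leq_trans IH1) // ?andbT; last by rewrite -addn2 leq_addr.
rewrite -mulrA mul_polyC (leq_trans (size_scale_leq _ _)) //.
by rewrite (leq_trans (size_polyMleq _ _)) // size_polyX.
Qed.

Lemma coef_cheb_top (R : nzRingType) n : (cheb n.+1 : {poly R})`_n.+1 = 2 ^+ n.
Proof.
elim: n => [|n IH]; first by rewrite coefX.
rewrite chebSS coefB -mulrA coefCM coefXM /= IH -exprS.
by rewrite [X in _ - X]nth_default ?subr0 // (leq_trans (size_cheb _ _)).
Qed.

Lemma cheb_norm_le1 (R : realType) n (x : R) : -1 <= x <= 1 -> `|(cheb n).[x]| <= 1.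
Proof. by move=> x1; rewrite -(acosK x1) horner_cheb_cos cos_max. Qed.

Definition cheb_nodes (R : realType) n : seq R :=
  [seq cos ((2 * i%:R + 1) * pi / (2 * n%:R)) | i <- iota 0 n].

Lemma cheb_nodes_root (R : realType) n (x : R) : x \in cheb_nodes R n -> (cheb n).[x] = 0.
Proof.
case/mapP => i; rewrite mem_iota add0n => /= i_n ->; rewrite horner_cheb_cos.
have n0 : n%:R != 0 :> R by rewrite pnatr_eq0; case: n i_n.
have -> : n%:R * ((2 * i%:R + 1) * pi / (2 * n%:R)) = i%:R * pi + pi / 2 :> R.
  by field.
rewrite cosDpihalf; apply/eqP; rewrite oppr_eq0; apply/eqP.
elim: i {i_n} => [|i IH]; first by rewrite mul0r sin0.
by rewrite -natr1 mulrDl mul1r sinDpi IH oppr0.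
Qed.

(** The angles are distinct points of [0, pi], where cos is injective. *)
Lemma cheb_nodes_uniq (R : realType) n : uniq (cheb_nodes R n).
Proof.
rewrite map_inj_in_uniq ?iota_uniq // => i j; rewrite !mem_iota !add0n /= => i_n j_n.
have n0 : 0 < n%:R :> R by rewrite ltr0n; case: n i_n {j_n}.
have pi0 := @pi_gt0 R.
have itv m : (m < n)%N -> (2 * m%:R + 1) * pi / (2 * n%:R) \in `[0, pi : R].
  move=> mn; rewrite in_itv /=; apply/andP; split.
    by rewrite divr_ge0 ?(ltW pi0, mulr_ge0, addr_ge0, ler0n).
  rewrite ler_pdivrMr ?mulr_gt0 // [leRHS]mulrC ler_pM2r //.
  have : m.+1%:R <= n%:R :> R by rewrite ler_nat.
  by rewrite -natr1; lra.
move=> /(cos_inj (itv _ i_n) (itv _ j_n)) h.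
have {}h : (2 * i%:R + 1) * pi = (2 * j%:R + 1) * pi :> R.
  by move: h => /divIf; apply; rewrite gt_eqF // mulr_gt0.
move/mulIf : h => /(_ (lt0r_neq0 pi0)) h.
have {h} : i%:R = j%:R :> R by lra.
by move=> /eqP; rewrite eqr_nat => /eqP.
Qed.

(** Newton's scheme: a new node y is matched by adding a multiple of the polynomial [q] that
    vanishes exactly at the earlier nodes. *)
Lemma interpolation_poly (R : fieldType) (f : R -> R) (s : seq R) : uniq s ->
  exists p : {poly R}, (size p <= size s)%N /\ forall x, x \in s -> p.[x] = f x.
Proof.
elim: s => [|y s IH] /=; first by exists 0; rewrite size_poly0.
case/andP => ys /IH[p [sp pf]].
pose q : {poly R} := \prod_(x <- s) ('X - x%:P).
have qy : q.[y] != 0.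
  by rewrite -rootE /q root_prod_XsubC.
exists (p + ((f y - p.[y]) / q.[y]) *: q); split.
  rewrite (leq_trans (size_polyD _ _)) // geq_max (leq_trans sp) //=.
  by rewrite (leq_trans (size_scale_leq _ _)) // /q size_prod_XsubC.
move=> x; rewrite in_cons => /orP[/eqP->|xs].
  by rewrite !hornerE divfK // subrKC.
rewrite !hornerE pf // (_ : q.[x] = 0) ?mulr0 ?addr0 //.
by apply/eqP; rewrite -rootE /q root_prod_XsubC.
Qed.

(** Rolle gives a zero of g in each gap of the increasing list x :: s. The zero c found between x
    and y can be prepended to the zeros found beyond y, which keeps the result a [path]. *)
Lemma rolle_zeros (R : realType) (f g : R -> R) (x : R) (s : seq R) :
  (forall t, is_derive t (1 : R) f (g t)) -> path <%R x s ->
  f x = 0 -> (forall y, y \in s -> f y = 0) ->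
  exists s', [/\ size s' = size s, path <%R x s' & forall y, y \in s' -> g y = 0].
Proof.
move=> fg; elim: s x => [|y s IH] x /=; first by exists [::].
case/andP => xy ys fx fs.
have fy : f y = 0 by apply: fs; rewrite mem_head.
have [|s' [ss ys' gs']] := IH y ys fy.
  by move=> z zs; apply: fs; rewrite in_cons zs orbT.
have cf : {within `[x, y], continuous f}%classic.
  apply: continuous_subspaceT => z.
  exact/differentiable_continuous/derivable1_diffP/(@ex_derive _ _ _ _ _ _ _ (fg z)).
have [||c] := @Rolle R f x y xy _ cf.
- by move=> z _; apply: (@ex_derive _ _ _ _ _ _ _ (fg z)).
- by rewrite fx fy.
rewrite in_itv /= => /andP[xc cy] fc0.
exists (c :: s'); split => /=; first by rewrite ss.
- rewrite xc /=; case: s' ys' {ss gs'} => //= z s' /andP[yz ->].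
  by rewrite (lt_trans cy yz).
- move=> z; rewrite in_cons => /orP[/eqP->|]; last exact: gs'.
  by rewrite -(@derive_val _ _ _ _ _ _ _ (fg c)) (@derive_val _ _ _ _ _ _ _ fc0).
Qed.

(** [G i] is the i-th derivative of [G 0]. Once the zeros are sorted, each use of [rolle_zeros]
    loses one of them, from n + 1 down to 1. *)
Lemma iterated_rolle (R : realType) n (G : nat -> R -> R) (s : seq R) :
  (forall i t, is_derive t (1 : R) (G i) (G i.+1 t)) -> uniq s -> size s = n.+1 ->
  (forall x, x \in s -> G 0 x = 0) -> exists xi, G n xi = 0.
Proof.
move=> hG us ss zs.
have {us ss zs} : exists x s, [/\ path <%R x s, size s = n, G 0 x = 0 &
    forall y, y \in s -> G 0 y = 0].
  have := mem_sort <=%R s; have := sort_lt_sorted s; rewrite us.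
  move: (size_sort <=%R s); rewrite ss.
  case: (sort <=%R s) => //= x s' [sz] ps ms; exists x, s'; split => //.
    by apply: zs; rewrite -ms mem_head.
  by move=> y ys; apply: zs; rewrite -ms in_cons ys orbT.
elim: n G hG => [|n IH] G hG [x [s0 [ps ss gx gs]]]; first by exists x.
have [s' [ss' ps' gs']] := rolle_zeros _ (G 0) (G 1) x s0 (hG 0) ps gx gs.
have [|xi Gxi] := IH (fun i => G i.+1) (fun i => hG i.+1).
  rewrite {}ss in ss'; case: s' ss' ps' gs' => //= y s' [ss'] /andP[_ ps'] gs'.
  exists y, s'; split => //; first by apply: gs'; rewrite mem_head.
  by move=> z zs; apply: gs'; rewrite in_cons zs orbT.
by exists xi.
Qed.

Lemma derivn_size_le (R : nzRingType) n (p : {poly R}) : (size p <= n.+1)%N ->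
  p^`(n) = (p`_n *+ n`!)%:P.
Proof.
move=> sp; apply/polyP => i; rewrite coef_derivn coefC; case: i => [|i] /=.
  by rewrite addn0 ffactnn.
by rewrite nth_default ?mul0rn // (leq_trans sp) // addnS ltnS leq_addr.
Qed.

(* The error at x is (G n xi / n!) * cheb n x / 2^(n-1): Rolle is applied n times
   to G 0 - p - K * cheb n, with K chosen to make x one more zero. *)
Lemma cheb_interpolation (R : realType) n (G : nat -> R -> R) (B : R) : (0 < n)%N ->
  (forall i t, is_derive t (1 : R) (G i) (G i.+1 t)) -> (forall t, `|G n t| <= B) ->
  exists p : {poly R}, (size p <= n)%N /\
    forall x, -1 <= x <= 1 -> `|G 0 x - p.[x]| <= 2 * (B / (2 ^+ n * n`!%:R)).
Proof.
move=> n0 hG GB.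
have [p [sp pf]] := interpolation_poly R (G 0) (cheb_nodes R n) (cheb_nodes_uniq R n).
rewrite size_map size_iota in sp; exists p; split => // x x1.
have B0 : 0 <= B := le_trans (normr_ge0 _) (GB 0).
have C0 : 0 < 2 ^+ n * n`!%:R :> R by rewrite mulr_gt0 ?exprn_gt0 ?ltr0n ?fact_gt0.
have [xs|xs] := boolP (x \in cheb_nodes R n).
  by rewrite pf // subrr normr0 mulr_ge0 // divr_ge0 // ltW.
have [c0|c0] := eqVneq (cheb n).[x] 0.
  (* A zero x of [cheb n] outside the nodes would give n + 1 distinct roots to a nonzero polynomial
     of degree at most n. *)
  exfalso; have := @max_poly_roots R (cheb n) (x :: cheb_nodes R n).
  rewrite /= xs cheb_nodes_uniq size_map size_iota => H.
  have cn0 : cheb n != 0 :> {poly R}.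
    apply/eqP => /(congr1 (fun q : {poly R} => q`_n)); rewrite coef0.
    by case: (n) n0 => // m _; rewrite coef_cheb_top => /eqP;
      rewrite expf_eq0 pnatr_eq0 andbF.
  have {}H : (n.+1 < size (cheb n : {poly R}))%N.
    apply: H => //; rewrite rootE c0 eqxx /=; apply/allP => y ys.
    by rewrite rootE cheb_nodes_root.
  by have := leq_trans H (size_cheb R n); rewrite ltnn.
pose K := (G 0 x - p.[x]) / (cheb n).[x].
pose q := p + K *: cheb n.
have [xi] : exists xi, G n xi - (q^`(n)).[xi] = 0.
  apply: (@iterated_rolle R n (fun i t => G i t - (q^`(i)).[t]) (x :: cheb_nodes R n)).
  - by rewrite /= xs cheb_nodes_uniq.
  - by rewrite /= size_map size_iota.
  - move=> y; rewrite derivn0 /q !hornerE in_cons => /orP[/eqP->|ys].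
      by rewrite /K divfK // subrKC subrr.
    by rewrite pf // cheb_nodes_root // mulr0 addr0 subrr.
have sq : (size q <= n.+1)%N.
  rewrite (leq_trans (size_polyD _ _)) // geq_max (leq_trans sp) //=.
  by rewrite (leq_trans (size_scale_leq _ _)) // size_cheb.
rewrite derivn_size_le // hornerC coefD coefZ [p`_n]nth_default // add0r => /subr0_eq Gxi.
have -> : G 0 x - p.[x] = K * (cheb n).[x] by rewrite /K divfK.
rewrite normrM (le_trans (ler_wpM2l (normr_ge0 _) (cheb_norm_le1 R n x x1))) // mulr1.
(* The n-th derivative of [q] is the constant K * 2^(n-1) * n!; doubling turns 2^(n-1) into 2^n. *)
have {}Gxi : K * (2 ^+ n * n`!%:R) = 2 * G n xi.
  rewrite Gxi; case: (n) n0 => // m _;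
    rewrite coef_cheb_top -[_ *+ _`!]mulr_natr exprS; ring.
rewrite mulrA ler_pdivlMr // -[X in _ * X <= _](gtr0_norm C0) -normrM Gxi normrM.
by rewrite ger0_norm // ler_pM2l.
Qed.

(** * Square-integrable functions and max-min *)

Section SquareIntegrable.
Context {d : measure_display} {T : measurableType d} {R : realType}.
Variables (mu : {measure set T -> \bar R}) (D : set T).
Hypothesis mD : measurable D.

Definition sqr_integrable (f : T -> R) :=
  measurable_fun D f /\ mu.-integrable D (EFin \o (fun x => f x ^+ 2)).

Definition dotp (f g : T -> R) := \int[mu]_(x in D) (f x * g x).

(** |f g| <= f^2 + g^2, from (|f| - |g|)^2 >= 0. *)
Lemma sqr_integrable_mul f g : sqr_integrable f -> sqr_integrable g ->
  mu.-integrable D (EFin \o (fun x => f x * g x)).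
Proof.
move=> [mf if2] [mg ig2].
apply: (le_integrable mD _ _ (integrableD mD if2 ig2)).
  by apply/measurable_EFinP; apply: measurable_funM.
move=> x _ /=; rewrite lee_fin [leRHS]ger0_norm ?addr_ge0 ?sqr_ge0 // normrM.
rewrite -(real_normK (num_real (f x))) -(real_normK (num_real (g x))).
have := sqr_ge0 (`|f x| - `|g x|); nra.
Qed.

Lemma sqr_integrable0 : sqr_integrable (fun=> 0).
Proof.
split; first exact: measurable_cst.
apply: (eq_integrable mD (cst 0%E)); last exact: integrable0.
by move=> x _ /=; rewrite expr0n.
Qed.

Lemma sqr_integrable_lin a b f g : sqr_integrable f -> sqr_integrable g ->
  sqr_integrable (fun x => a * f x + b * g x).
Proof.
move=> sf sg; have [mf if2] := sf; have [mg ig2] := sg; split.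
  by apply: measurable_funD; apply: measurable_funM => //; exact: measurable_cst.
have ifg := sqr_integrable_mul f g sf sg.
apply: (eq_integrable mD) (integrableD mD (integrableD mD
  (integrableZl mD (a ^+ 2) if2) (integrableZl mD (b ^+ 2) ig2))
  (integrableZl mD (2 * a * b) ifg)).
by move=> x _ /=; rewrite -!EFinM -!EFinD; congr EFin; ring.
Qed.

Lemma sqr_integrable_sum (I : Type) (s : seq I) (c : I -> R) (f : I -> T -> R) :
  (forall i, sqr_integrable (f i)) ->
  sqr_integrable (fun x => \sum_(i <- s) c i * f i x).
Proof.
move=> sf; elim: s => [|i s IH].
  by under eq_fun do rewrite big_nil; exact: sqr_integrable0.
under eq_fun do rewrite big_cons -[X in _ + X]mul1r.
exact: sqr_integrable_lin.
Qed.

Lemma bounded_sqr_integrable (B : R) (f : T -> R) :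
  (mu D < +oo)%E -> measurable_fun D f ->
  (forall x, D x -> `|f x| <= B) -> sqr_integrable f.
Proof.
move=> muD mf fB; split => //; apply: measurable_bounded_integrable => //.
  exact: measurable_funX.
exists (B ^+ 2); split; first exact: num_real.
move=> M BM x Dx /=; apply: (le_trans _ (ltW BM)).
by rewrite normrX lerXn2r ?nnegrE ?fB // (le_trans _ (fB x Dx)).
Qed.

Lemma dotpC f g : dotp f g = dotp g f.
Proof. by apply: eq_Rintegral => x _; rewrite mulrC. Qed.

Lemma dotp_lin a b f g h :
  sqr_integrable f -> sqr_integrable g -> sqr_integrable h ->
  dotp (fun x => a * f x + b * g x) h = a * dotp f h + b * dotp g h.
Proof.
move=> sf sg sh; rewrite /dotp.
rewrite -!RintegralZl //; try exact: sqr_integrable_mul.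
rewrite -RintegralD //.
- by apply: eq_Rintegral => x _; ring.
- by apply: (integrableZl mD) (sqr_integrable_mul _ _ _ _).
- by apply: (integrableZl mD) (sqr_integrable_mul _ _ _ _).
Qed.

Lemma dotp_sum (I : Type) (s : seq I) (c : I -> R) (f : I -> T -> R) h :
  (forall i, sqr_integrable (f i)) -> sqr_integrable h ->
  dotp (fun x => \sum_(i <- s) c i * f i x) h = \sum_(i <- s) c i * dotp (f i) h.
Proof.
move=> sf sh; elim: s => [|i s IH].
  rewrite big_nil /dotp -[RHS](mul0r (fine (mu D))) -(Rintegral_cst mu mD).
  by apply: eq_Rintegral => x _; rewrite big_nil mul0r.
rewrite big_cons -IH -[X in _ = _ + X]mul1r -dotp_lin //;
  last exact: sqr_integrable_sum.
by apply: eq_Rintegral => x _; rewrite big_cons mul1r.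
Qed.

Lemma dotp_ge0 f : 0 <= dotp f f.
Proof. by apply: Rintegral_ge0 => x _; rewrite -expr2 sqr_ge0. Qed.

Lemma dotp_eq0 f : sqr_integrable f -> dotp f f = 0 ->
  {ae mu, forall x, D x -> f x = 0}.
Proof.
move=> sf; rewrite /dotp /Rintegral => f0.
have iff := sqr_integrable_mul f f sf sf.
have mff := measurable_int mu iff.
have : (\int[mu]_(x in D) `|((f x * f x)%R)%:E|)%E = 0%E.
  rewrite -[RHS]/(0%:E) -f0 fineK; last exact: integrable_fin_num.
  apply: eq_integral => x _ /=.
  by rewrite ger0_norm // -expr2 sqr_ge0.
move/(ae_eq_integral_abs mu mD mff); apply: filterS => x H /H /= [].
by move/eqP; rewrite mulf_eq0 orbb => /eqP.
Qed.

Lemma ae_dotp f f' g : measurable_fun D f -> measurable_fun D f' ->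
  measurable_fun D g -> {ae mu, forall x, D x -> f x = f' x} ->
  dotp f g = dotp f' g.
Proof.
move=> mf mf' mg ff'; congr fine; apply: ae_eq_integral => //.
- by apply/measurable_EFinP; apply: measurable_funM.
- by apply/measurable_EFinP; apply: measurable_funM.
- by apply: filterS ff' => x H /H ->.
Qed.

(** With F = <f, f>, s = <f, g> and G = <g, g>, the squared norm of F g - s f is F (F G - s^2) >= 0,
    and F > 0 cancels. *)
Lemma dotp_cauchy_schwarz f g : sqr_integrable f -> sqr_integrable g ->
  0 < dotp f f -> dotp f g ^+ 2 <= dotp f f * dotp g g.
Proof.
move=> sf sg F0; set F := dotp f f in F0 *; set s := dotp f g; set G := dotp g g.
have := dotp_ge0 (fun x => F * g x + (- s) * f x).
have sh := sqr_integrable_lin F (- s) g f sg sf.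
rewrite dotp_lin // ![dotp _ (fun x => F * g x + _)]dotpC !dotp_lin //.
rewrite [dotp g f]dotpC -/F -/s -/G => H.
have {H} : 0 <= F * (F * G - s ^+ 2).
  by move: H; congr (_ <= _); ring.
by rewrite pmulr_rge0 // subr_ge0.
Qed.

Lemma dotp_le_bound (B : R) (f : T -> R) : (mu D < +oo)%E -> measurable_fun D f ->
  (forall x, D x -> `|f x| <= B) -> dotp f f <= fine (mu D) * B ^+ 2.
Proof.
move=> muD mf fB; have sf := bounded_sqr_integrable B f muD mf fB.
rewrite mulrC -(Rintegral_cst mu mD); apply: le_Rintegral => //.
- exact: sqr_integrable_mul.
- apply: measurable_bounded_integrable => //.
  exists (`|B ^+ 2|); split; first exact: num_real.
  by move=> M BM x _ /=; apply: ltW.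
- move=> x Dx; rewrite -expr2 -(real_normK (num_real (f x))).
  by rewrite lerXn2r ?nnegrE ?fB // (le_trans _ (fB x Dx)).
Qed.

End SquareIntegrable.

(** The vector c is a left null vector of [A]. Columns m < k carry the orthogonality conditions,
    columns m > k force c m = 0, and column k is left zero, so the determinant vanishes. *)
Lemma exists_orthogonal_combination (F : fieldType) N (k : 'I_N) (a : 'I_N -> nat -> F) :
  exists c : 'I_N -> F, [/\ exists l, c l != 0,
    forall l : 'I_N, (k < l)%N -> c l = 0 &
    forall m, (m < k)%N -> \sum_(l < N) c l * a l m = 0].
Proof.
pose A : 'M[F]_N := \matrix_(l, m)
  if (m < k)%N then a l m else if (k < m)%N then (l == m)%:R else 0.
have /det0P[v v0 vA] : \det A == 0.
  rewrite (expand_det_col _ k) big1 // => i _.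
  by rewrite mxE !ltnn mul0r.
have vAm m : \sum_l v 0 l * A l m = 0.
  by move/rowP/(_ m): vA; rewrite !mxE.
exists (fun l => v 0 l); split.
- by case/rV0Pn: v0 => l vl; exists l.
- move=> l kl; have := vAm l; rewrite (bigD1 l) //= mxE ltnNge (ltnW kl) /= kl eqxx mulr1.
  rewrite big1 ?addr0 // => i il; rewrite mxE ltnNge (ltnW kl) /= kl.
  by rewrite (negPf il) mulr0.
- move=> m mk; have := vAm (Ordinal (ltn_trans mk (ltn_ord k))).
  by under eq_bigr do rewrite mxE /= mk.
Qed.

(* Max-min: on the span of psi_0, ..., psi_k the quadratic form is at least
   lam k, and some nonzero f in that span is orthogonal to p_0, ..., p_(k-1). *)
Lemma eigenvalue_le_approximation_error d (T : measurableType d) (R : realType)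
    (mu : {measure set T -> \bar R}) (D : set T) (I : finType)
    (phi : I -> T -> R) (E : I -> R) N (lam : 'I_N -> R) (psi : 'I_N -> T -> R)
    (k : 'I_N) (p : nat -> T -> R) (q : I -> 'I_k -> R) :
  measurable D -> (mu D < +oo)%E ->
  (forall i, sqr_integrable mu D (phi i)) ->
  (forall l, sqr_integrable mu D (psi l)) ->
  (forall m, sqr_integrable mu D (p m)) ->
  (forall i j : 'I_N, (i <= j)%N -> lam j <= lam i) ->
  (forall l, {ae mu, forall x, D x ->
     \sum_i dotp mu D (psi l) (phi i) * phi i x = lam l * psi l x}) ->
  (forall c : 'I_N -> R,
    {ae mu, forall x, D x -> \sum_(l < N) c l * psi l x = 0} -> forall l, c l = 0) ->
  (forall i x, D x -> `|phi i x - \sum_(m < k) q i m * p m x| <= E i) ->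
  lam k <= fine (mu D) * \sum_i E i ^+ 2.
Proof.
move=> mD muD sphi spsi sp lam_mono eig indep approx.
pose dot := dotp mu D.
pose A l i := dot (psi l) (phi i).
pose G l m := dot (psi l) (psi m).
have GC l m : G l m = G m l by apply: dotpC.
(* Pair the eigenvalue equation of psi_l with psi_m; [G] is the Gram matrix. *)
have lamG l m : lam l * G l m = \sum_i A l i * A m i.
  transitivity (dot (fun x => \sum_i A l i * phi i x) (psi m)).
    transitivity (dot (fun x => lam l * psi l x + 0 * psi l x) (psi m)).
      by rewrite /dot dotp_lin // mul0r addr0.
    apply: ae_dotp => //.
    - by case: (sqr_integrable_lin mu D mD (lam l) 0 _ _ (spsi l) (spsi l)).
    - by case: (sqr_integrable_sum mu D mD I (index_enum I) (A l) phi sphi).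
    - by case: (spsi m).
    - by apply: filterS (eig l) => x H Dx; rewrite mul0r addr0 -H.
  rewrite /dot dotp_sum //; apply: eq_bigr => i _.
  by rewrite dotpC.
(* Symmetry of the form: eigenfunctions for distinct eigenvalues are orthogonal, so only equal
   eigenvalues contribute to the Gram matrix. *)
have lamGC l m : lam l * G l m = lam m * G l m.
  by rewrite lamG GC lamG; apply: eq_bigr => i _; rewrite mulrC.
have [c [[l0 cl0] ck corth]] :=
  exists_orthogonal_combination R N k (fun l m => dot (psi l) (p m)).
pose f x := \sum_(l < N) c l * psi l x.
have sf : sqr_integrable mu D f by apply: sqr_integrable_sum.
have F0 : 0 < dot f f.
  rewrite lt_def dotp_ge0 andbT; apply: contra_neq cl0 => F0.
  by apply: indep; exact: dotp_eq0 F0.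
have dotf (b : 'I_N -> R) h : sqr_integrable mu D h ->
    dot (fun x => \sum_(l < N) b l * psi l x) h = \sum_(l < N) b l * dot (psi l) h.
  by move=> sh; rewrite /dot dotp_sum.
have gram (b : 'I_N -> R) : dot (fun x => \sum_(l < N) b l * psi l x)
    (fun x => \sum_(l < N) b l * psi l x) = \sum_l \sum_m b l * b m * G l m.
  rewrite dotf; last exact: sqr_integrable_sum.
  apply: eq_bigr => l _; rewrite /dot dotpC -/dot dotf //.
  rewrite mulr_sumr; apply: eq_bigr => m _.
  by rewrite -/(G m l) GC mulrA.
have lower : lam k * dot f f <= \sum_i dot f (phi i) ^+ 2.
  have -> : \sum_i dot f (phi i) ^+ 2 = \sum_l \sum_m c l * c m * (lam l * G l m).
    transitivity (\sum_i \sum_l \sum_m c l * c m * (A l i * A m i)).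
      apply: eq_bigr => i _; rewrite /f dotf // expr2 mulr_suml.
      apply: eq_bigr => l _; rewrite mulr_sumr; apply: eq_bigr => m _.
      rewrite -/(A l i) -/(A m i); ring.
    rewrite exchange_big; apply: eq_bigr => l _.
    rewrite exchange_big; apply: eq_bigr => m _.
    by rewrite lamG mulr_sumr.
  rewrite gram mulr_sumr -subr_ge0 -sumrB.
  (* The difference of the two sides is the squared norm of the sum of r_l c_l psi_l: where G l m is
     nonzero, r l = r m. For l > k the square root may take its default value 0, but there c l =
     0. *)
  pose r l := Num.sqrt (lam l - lam k).
  have := dotp_ge0 mu D (fun x => \sum_(l < N) (r l * c l) * psi l x).
  rewrite -/dot gram; congr (_ <= _); apply: eq_bigr => l _.
  rewrite mulr_sumr -sumrB; apply: eq_bigr => m _.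
  have [->|Glm] := eqVneq (G l m) 0; first by rewrite !mulr0 subrr.
  have [lk|kl] := leqP l k; last by rewrite (ck l kl) !(mulr0, mul0r) subrr.
  have lm : lam l = lam m by apply/(mulIf Glm)/lamGC.
  have rr : r l * r m = lam l - lam k.
    by rewrite /r -lm -expr2 sqr_sqrtr // subr_ge0 lam_mono.
  transitivity ((r l * r m) * (c l * c m * G l m)); first by ring.
  rewrite rr; ring.
(* As f is orthogonal to the approximant g of phi_i, <f, phi_i> = <f, phi_i - g>, to which
   Cauchy-Schwarz applies. *)
have upper i : dot f (phi i) ^+ 2 <= dot f f * (fine (mu D) * E i ^+ 2).
  pose g x := \sum_(m < k) q i m * p m x.
  have sg : sqr_integrable mu D g by apply: sqr_integrable_sum.
  have fg : dot f g = 0.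
    rewrite /dot dotpC dotp_sum // big1 // => m _.
    by rewrite dotpC -/dot /f dotf // corth // mulr0.
  pose e x := 1 * phi i x + (- 1) * g x.
  have se : sqr_integrable mu D e by apply: sqr_integrable_lin.
  have -> : dot f (phi i) = dot f e.
    rewrite [RHS]dotpC dotp_lin // [dotp _ _ g _]dotpC -/dot fg mulr0 addr0 mul1r.
    exact: dotpC.
  apply: (le_trans (dotp_cauchy_schwarz mu D mD f e sf se F0)).
  rewrite ler_pM2l //; apply: dotp_le_bound => //; first by case: se.
  by move=> x Dx; rewrite /e mul1r mulN1r approx.
rewrite -(ler_pM2r F0) (le_trans lower) //.
rewrite mulrC mulr_sumr mulr_sumr; apply: ler_sum => i _; exact: upper.
Qed.

(** * The sinc kernel *)

(** Dirichlet kernel: 2 sin u cos(c u) = sin((c + 1) u) - sin((c - 1) u) with c = N - 1 - 2j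
    telescopes from sin(N u) to sin(-N u). *)
Lemma sum_cos_dirichlet (R : realType) N (u : R) :
  sin u * \sum_(j < N) cos ((N%:R - 1 - 2 * j%:R) * u) = sin (N%:R * u).
Proof.
suff : 2 * (sin u * \sum_(j < N) cos ((N%:R - 1 - 2 * j%:R) * u)) = 2 * sin (N%:R * u).
  by move/(mulfI (lt0r_neq0 (ltr0Sn R 1))).
rewrite mulrA mulr_sumr.
have -> : \sum_(j < N) 2 * sin u * cos ((N%:R - 1 - 2 * j%:R) * u) =
  \sum_(0 <= j < N) (- sin ((N%:R - 2 * j.+1%:R) * u) - - sin ((N%:R - 2 * j%:R) * u)).
  rewrite big_mkord; apply: eq_bigr => j _.
  have -> : (N%:R - 2 * j.+1%:R) * u = (N%:R - 1 - 2 * j%:R) * u - u :> R.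
    by rewrite -[j.+1%:R]natr1; ring.
  have -> : (N%:R - 2 * j%:R) * u = (N%:R - 1 - 2 * j%:R) * u + u :> R by ring.
  rewrite sinB sinD; ring.
rewrite (@telescope_sumr_eq _ _ _ (fun j => - sin ((N%:R - 2 * j%:R) * u))) //.
have -> : (N%:R - 2 * N%:R) * u = - (N%:R * u) :> R by ring.
rewrite sinN mulr0 subr0; ring.
Qed.

(* cos (c_j x) for i = (j, true), and sin (c_j x) = cos (c_j x - pi / 2) for
   i = (j, false). *)
Definition trig {R : realType} N (i : 'I_N * bool) (x : R) : R :=
  cos ((N%:R - 1 - 2 * i.1%:R) * pi * x + (if i.2 then 0 else - (pi / 2))).

Lemma trig_pair {R : realType} N (j : 'I_N) (x y : R) :
  trig N (j, true) x * trig N (j, true) y + trig N (j, false) x * trig N (j, false) y =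
  cos ((N%:R - 1 - 2 * j%:R) * (pi * (x - y))).
Proof.
rewrite /trig /= !addr0 !cosBpihalf -cosB; congr cos; ring.
Qed.

Lemma Qkernel_trig {R : realType} N (x y : R) : sin (pi * (x - y)) != 0 ->
  Qkernel N (x - y) = \sum_i trig N i x * trig N i y.
Proof.
move=> s0; rewrite /Qkernel -mulrA -sum_cos_dirichlet mulrC mulKf //.
rewrite -(pair_bigA _ (fun j b => trig N (j, b) x * trig N (j, b) y)) /=.
by apply: eq_bigr => j _; rewrite big_bool /= trig_pair.
Qed.

Lemma continuous_trig {R : realType} N i : continuous (@trig R N i).
Proof.
move=> x; apply: continuous_comp; last exact: continuous_cos.
apply: continuousD; last exact: cst_continuous.
by apply: continuousM; [exact: cst_continuous|exact: cvg_id].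
Qed.

(** * The operator on (-W, W) as a finite trigonometric sum *)

Section Operator.
Context {R : realType}.
Variable W : R.
Hypothesis W0 : 0 < W.
Let D : set R := `]- W, W[%classic.
Let mu := @lebesgue_measure R.

Lemma lebesgue_measure_sym_itv : mu D = (2 * W)%:E.
Proof.
rewrite /mu /D lebesgue_measure_itv /= lte_fin (@lt_trans _ _ 0 (- W) W) ?oppr_lt0 //.
by rewrite -EFinB; congr EFin; ring.
Qed.

Lemma sym_itv_finite_measure : (mu D < +oo)%E.
Proof. by rewrite lebesgue_measure_sym_itv ltry. Qed.

Lemma measurable_sym_itv : measurable (D : set (measurableTypeR R)).
Proof. exact: measurable_itv. Qed.

Lemma trig_sqr_integrable N i : sqr_integrable mu D (trig N i).
Proof.
apply: (@bounded_sqr_integrable _ _ _ _ _ measurable_sym_itv 1);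
  first exact: sym_itv_finite_measure.
  apply: measurable_funTS; apply: continuous_measurable_fun; exact: continuous_trig.
by move=> x _; rewrite cos_max.
Qed.

Lemma monomial_sqr_integrable m : sqr_integrable mu D (fun x => (x / W) ^+ m).
Proof.
apply: (@bounded_sqr_integrable _ _ _ _ _ measurable_sym_itv 1);
  first exact: sym_itv_finite_measure.
  by apply: measurable_funX; apply: measurable_funM => //; exact: measurable_cst.
move=> x; rewrite /D /= in_itv /= => /andP[x1 x2].
rewrite normrX exprn_ile1 // normrM normfV (gtr0_norm W0) ler_pdivrMr // mul1r.
by rewrite ler_norml; apply/andP; split; apply: ltW.
Qed.

(** The restricted measure of A is the Lebesgue measure of A [&] D, so the exceptional set is cut
    down to D. *)
Lemma ae_mu_itv (P Q : R -> Prop) : (forall x, D x -> P x -> Q x) ->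
  {ae mu_itv W, forall x, P x} -> {ae mu, forall x, D x -> Q x}.
Proof.
move=> PQ [A [mA A0 PA]]; exists (A `&` D)%classic; split.
- by apply: measurableI => //; exact: measurable_sym_itv.
- exact: A0.
- move=> x /= /not_implyP[Dx Qx]; split => //; apply: PA => /= Px.
  exact/Qx/PQ.
Qed.

(** Conversely, the complement of D is null for [mu_itv W] and joins the exceptional set. *)
Lemma mu_itv_ae (P : R -> Prop) : {ae mu, forall x, D x -> P x} ->
  {ae mu_itv W, forall x, P x}.
Proof.
move=> [A [mA A0 PA]]; exists (A `|` ~` D)%classic; split.
- by apply: measurableU => //; apply: measurableC; exact: measurable_sym_itv.
- rewrite /mu_itv /= /mrestr setIUl setICl setU0.
  apply: (subset_measure0 _ _ _ A0) => //.
  by apply: measurableI => //; exact: measurable_sym_itv.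
- move=> x /= Px; have [Dx|Dx] := pselect (D x); last by right.
  by left; apply: PA => /= H; apply: Px; apply: H.
Qed.

Lemma Lfun_sqr_integrable (f : R -> R) : f \in Lfun (mu_itv W) 2%:E ->
  sqr_integrable mu D f.
Proof.
move=> Lf; have /integrableP[mf2 f2y] := Lfun2_integrable_sqr Lf.
have mf : measurable_fun setT f by move: Lf; rewrite inE => /andP[]; rewrite inE.
split; first exact: measurable_funTS.
apply/integrableP; split; first exact: measurable_funTS.
rewrite (eq_measure_integral (mu_itv W)); last first.
  by move=> A mA AD; rewrite /mu_itv /= /mrestr setIidl.
apply: le_lt_trans f2y; apply: ge0_subset_integral => //.
  exact: measurable_sym_itv.
exact: measurableT_comp.
Qed.

(** For y <> x in D, W < 1/2 gives 0 < |pi (x - y)| < pi, so the sine in the denominator is nonzero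
    and [Qkernel_trig] applies. The point y = x, where the quotient is 0 but the sum is N, is
    removed as a null set. *)
Lemma Qtilde_trig N (f : R -> R) x : W < 1 / 2 -> sqr_integrable mu D f -> D x ->
  Qtilde W N f x = \sum_i dotp mu D f (trig N i) * trig N i x.
Proof.
move=> W2 sf Dx.
transitivity (dotp mu D (fun y => \sum_i trig N i x * trig N i y) f); last first.
  rewrite (@dotp_sum _ _ _ _ _ measurable_sym_itv) //; last exact: trig_sqr_integrable.
  by apply: eq_bigr => i _; rewrite mulrC dotpC.
have sK : sqr_integrable mu D (fun y => \sum_i trig N i x * trig N i y).
  apply: sqr_integrable_sum; first exact: measurable_sym_itv.
  exact: trig_sqr_integrable.
have mDx : measurable (D `\ x : set (measurableTypeR R))%classic.
  by apply: measurableD => //; exact: measurable_sym_itv.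
have eqK y : (D `\ x)%classic y ->
  Qkernel N (x - y) * f y = (\sum_i trig N i x * trig N i y) * f y.
  move=> [Dy yx]; congr (_ * _); apply: Qkernel_trig.
  have pi0 := @pi_gt0 R.
  move: Dx Dy; rewrite /D /= !in_itv /= => /andP[x1 x2] /andP[y1 y2].
  have [xy|xy|xy] := ltgtP x y; last by case: yx.
    rewrite -opprB mulrN sinN oppr_eq0 gt_eqF // sin_gt0_pi //.
    by apply/andP; split; nra.
  by rewrite gt_eqF // sin_gt0_pi //; apply/andP; split; nra.
have mK : measurable_fun (D `\ x)%classic
   (fun y => (\sum_i trig N i x * trig N i y) * f y).
  have [mk _] := sK; have [mf _] := sf.
  by apply: measurable_funM; [apply: (measurable_funS _ _ mk)
    |apply: (measurable_funS _ _ mf)] => //; exact: measurable_sym_itv.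
rewrite /Qtilde /dotp /Rintegral; congr fine.
rewrite -(integral_setD1 mDx); last first.
  apply/measurable_EFinP; apply: eq_measurable_fun mK => y; rewrite inE => Dy.
  by rewrite eqK.
rewrite -[RHS](integral_setD1 mDx); last exact/measurable_EFinP.
by apply: eq_integral => y; rewrite inE => Dy; rewrite eqK.
Qed.

Lemma trig_approximation N k i : (0 < k)%N ->
  exists q : 'I_k -> R, forall x, D x ->
    `|trig N i x - \sum_(m < k) q m * (x / W) ^+ m| <=
    2 * (`|(N%:R - 1 - 2 * i.1%:R) * pi * W| ^+ k / (2 ^+ k * k`!%:R)).
Proof.
move=> k0; set c := (_ * pi); set a := c * W.
pose th : R := if i.2 then 0 else - (pi / 2).
(* The j-th derivative of the function t |-> trig N i (W t): each differentiation multiplies by a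
   and advances the phase by pi / 2. *)
pose G (j : nat) (t : R) := a ^+ j * cos (a * t + (th + j%:R * (pi / 2))).
have dG j t : is_derive t (1 : R) (G j) (G j.+1 t).
  have -> : G j.+1 t = a ^+ j * (- sin (a * t + (th + j%:R * (pi / 2))) * a).
    rewrite /G -[j.+1%:R]natr1 mulrDl mul1r !addrA cosDpihalf exprS; ring.
  apply: is_derive_eq; rewrite !(scaler0, addr0, scaler1, add0r) /GRing.scale /=; ring.
have Gb t : `|G k t| <= `|a| ^+ k.
  by rewrite /G normrM normrX ler_piMr ?exprn_ge0 // cos_max.
have [p [sp pG]] := cheb_interpolation R k G (`|a| ^+ k) k0 dG Gb.
exists (fun m => p`_m) => x; rewrite /D /= in_itv /= => /andP[x1 x2].
rewrite -horner_coef_wide //.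
have -> : trig N i x = G 0 (x / W).
  rewrite /trig /G expr0 mul1r mul0r addr0 -/c -/th; congr (cos (_ + _)).
  rewrite /a; field; lra.
apply: pG; rewrite ler_pdivrMr // ler_pdivlMr //.
by apply/andP; split; lra.
Qed.

End Operator.

(** * Numerical estimate and conclusion *)

(** [S] stands for the sum of the (N - 1 - 2j)^(2k). The exponential is (1/X)^(2k+1) with 1/X = u N
    e / (k + 1) and u = pi W / 2. After cancelling W u^(2k), the bound on [S] and
    [factorial_sqr_lower_bound] remain. *)
Lemma eigenvalue_tail_bound (R : realType) (W S : R) N k : (2 <= k)%N -> (0 < N)%N ->
  0 < W -> k.*2.+1%:R * S <= N%:R ^+ k.*2.+1 ->
  16 * W * ((pi * W / 2) ^+ k.*2 / k`!%:R ^+ 2) * S <=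
  2 * expR (- ((2 * k%:R + 1) * ln (2 / (expR 1 * pi * N%:R * W) * (k%:R + 1)))).
Proof.
move=> k2 N0 W0 hS.
have pi2 := @pi_ge2 R.
have NR : 0 < N%:R :> R by rewrite ltr0n.
have e0 := @expR_gt0 R 1.
have k10 : 0 < k%:R + 1 :> R by rewrite ltr_wpDl.
have f0 : 0 < k`!%:R ^+ 2 :> R by rewrite exprn_gt0 // ltr0n fact_gt0.
have pi0 := @pi_gt0 R.
set X := 2 / _ * _.
have X0 : 0 < X by rewrite /X mulr_gt0 // divr_gt0 // !mulr_gt0.
have -> : 2 * k%:R + 1 = k.*2.+1%:R :> R by rewrite -[k.*2.+1%:R]natr1 -mul2n natrM.
rewrite -mulrN -lnV ?posrE // expRM_natl lnK ?posrE ?invr_gt0 //.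
have -> : X^-1 = (pi * W / 2) * N%:R * expR 1 / (k%:R + 1).
  by rewrite /X; move: pi0; move: (pi : R) => p p0; field; rewrite !lt0r_neq0.
have main := factorial_sqr_lower_bound R k k2.
set u := pi * W / 2; have u0 : 0 < u by rewrite /u divr_gt0 // mulr_gt0.
have uE : u = pi * W / 2 by []; clearbody u.
rewrite !exprMn exprVn.
set K := k.*2.+1%:R in hS main; have K0 : 0 < K by rewrite ltr0n.
set f := k`!%:R ^+ 2 in f0 main *.
set Nn := N%:R ^+ _ in hS *; set en := expR 1 ^+ _ in main *.
set kn := (k%:R + 1) ^+ _ in main *.
have kn0 : 0 < kn by rewrite exprn_gt0.
have Nn0 : 0 < Nn by rewrite exprn_gt0.
rewrite [u ^+ k.*2.+1]exprS.
set U := u ^+ k.*2; have U0 : 0 < U by rewrite exprn_gt0.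
have -> : 2 * (u * U * Nn * en / kn) = (W * U) * (pi * (Nn * en / kn)).
  by rewrite uE; move: (pi : R) => p; field; rewrite lt0r_neq0.
have -> : 16 * W * (U / f) * S = (W * U) * (16 * S / f).
  by field; rewrite lt0r_neq0.
rewrite ler_pM2l ?mulr_gt0 //.
(* The pi left over from the extra factor u is bounded below by 2. *)
apply: (@le_trans _ _ (2 * (Nn * en / kn))); last first.
  by rewrite ler_pM2r // divr_gt0 // mulr_gt0 // exprn_gt0.
rewrite ler_pdivrMr // -(ler_pM2l K0).
apply: (@le_trans _ _ (16 * Nn)); first by lra.
have -> : K * (2 * (Nn * en / kn) * f) = 2 * Nn * ((en * K * f) / kn).
  by field; rewrite lt0r_neq0.
have -> : 16 * Nn = 2 * Nn * 8 by ring.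
by rewrite ler_pM2l ?mulr_gt0 // ler_pdivlMr.
Qed.

Theorem mainTheorem4 (R : realType) (N : nat) (hN : (3 <= N)%N)
  (W : R) (hW0 : 0 < W)
  (hW1 : W < 2 / (expR 1 * pi) * ((N%:R - 1) / N%:R))
  (lam : 'I_N -> R) (hlam : nonzero_eigenvalues W N lam)
  (k : 'I_N)
  (hk2 : 2 <= expR 1 * pi / 2 * N%:R * W)
  (hk : expR 1 * pi / 2 * N%:R * W <= k%:R) :
  lam k <= 2 * expR (- ((2 * k%:R + 1)
                        * ln (2 / (expR 1 * pi * N%:R * W) * (k%:R + 1)))).
Proof.
have k2 : (2 <= k)%N by rewrite -(ler_nat R); exact: le_trans hk2 hk.
have N0 : (0 < N)%N by exact: leq_trans hN.
(* e pi >= (5/2) * 2 = 5, so 2 / (e pi) < 1/2. *)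
have W2 : W < 1 / 2.
  apply: (lt_le_trans hW1); apply: (@le_trans _ _ (2 / (expR 1 * pi))).
    rewrite ler_piMr ?divr_ge0 ?mulr_ge0 ?expR_ge0 ?pi_ge0 //.
    by rewrite ler_pdivrMr ?ltr0n // mul1r gerBl.
  have e1 := expR1_ge52 R; have pi2 := @pi_ge2 R.
  rewrite ler_pdivrMr; last by rewrite mulr_gt0 ?expR_gt0 ?pi_gt0.
  nra.
case: hlam => lam_mono _ [psi [eig indep _]].
pose D : set R := `]- W, W[%classic.
have spsi l : sqr_integrable (@lebesgue_measure R) D (psi l).
  by case: (eig l) => Lf _; exact: Lfun_sqr_integrable Lf.
have k0 : (0 < k)%N by exact: leq_trans k2.
have [q hq] := choice (fun i => trig_approximation W hW0 N k i k0).
have := @eigenvalue_le_approximation_error _ _ R (@lebesgue_measure R) D _ (trig N)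
  _ N lam psi k (fun m x => (x / W) ^+ m) q
  (measurable_sym_itv W) (sym_itv_finite_measure W hW0)
  (trig_sqr_integrable W hW0 N) spsi (monomial_sqr_integrable W hW0) lam_mono _ _ hq.
move=> H; apply: (le_trans (H _ _)).
- move=> l; have [_ el] := eig l.
  apply: ae_mu_itv el => x Dx Hx.
  by rewrite -(Qtilde_trig W) // Hx.
- by move=> c /mu_itv_ae; exact: indep.
have -> : fine (@lebesgue_measure R D) = 2 * W.
  by rewrite (lebesgue_measure_sym_itv W hW0).
apply: le_trans (@eigenvalue_tail_bound R W
  (\sum_(j < N) (N%:R - 1 - 2 * j%:R) ^+ k.*2) N k k2 N0 hW0 (sum_even_power_le R N k)).
rewrite le_eqVlt; apply/orP; left; apply/eqP.
(* Cosine and sine of the same frequency share one error bound, so the constant is 2 W * 2 * 2^2 =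
   16 W. *)
rewrite -(pair_bigA _ (fun (j : 'I_N) (b : bool) =>
  (2 * (`|(N%:R - 1 - 2 * j%:R) * pi * W| ^+ k / (2 ^+ k * k`!%:R))) ^+ 2)) /=.
rewrite !mulr_sumr; apply: eq_bigr => j _; rewrite big_bool /=.
have sq : `|(N%:R - 1 - 2 * j%:R) * pi * W| ^+ k ^+ 2 =
    (N%:R - 1 - 2 * j%:R) ^+ k.*2 * (pi * W) ^+ k.*2 :> R.
  rewrite -exprMn -exprM mulnC exprM real_normK ?num_real // -exprM mul2n.
  by rewrite mulrA.
rewrite exprMn expr_div_n sq [in RHS]expr_div_n.
rewrite [(2 ^+ k * _) ^+ 2]exprMn -[2 ^+ k ^+ 2]exprM muln2.
by field; rewrite pnatr_eq0 -lt0n fact_gt0 expf_eq0 pnatr_eq0 andbF.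
Qed.
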